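(* Let $P_\ell$ denote the Legendre polynomial of degree $\ell$ (normalized by $P_\ell(1)=1$). Then $$B_4^{[-1,1]}[P_6](t)=\frac{347}{2048}+\frac{63}{64}t^2-\frac{315}{2048}t^4=\frac{239}{512}P_0(t)+\frac{291}{512}P_2(t)-\frac{9}{256}P_4(t).$$ Consequently, $P_6$ is positive-definite on $S^2$ but $B_4^{[-1,1]}[P_6]$ is not; that is, the affine Bernstein operator $B_4^{[-1,1]}$ does not preserve the cone of positive-definite zonal functions on $S^2$.
   Context: The affine Bernstein operator of degree $4$ on $[-1,1]$ is $$B_4^{[-1,1]}[f](t)=\sum_{j=0}^{4} f\Bigl(-1+\frac{j}{2}\Bigr)\binom{4}{j}\Bigl(\frac{1+t}{2}\Bigr)^j\Bigl(\frac{1-t}{2}\Bigr)^{4-j},\qquad t\in[-1,1].$$ A continuous function $\varphi:[-1,1]\to\mathbb{R}$ is positive-definite on $S^2$ (the unit sphere in $\mathbb{R}^3$) if for every finite set of points $x_1,\dots,x_N\in S^2$ the matrix $(\varphi(x_p\cdot x_q))_{p,q=1}^N$ is positive semidefinite. By Schoenberg's theorem, this is equivalent to an expansion $\varphi(t)=\sum_{\ell=0}^\infty a_\ell P_\ell(t)$ with $a_\ell\ge0$ and $\sum_{\ell=0}^\infty a_\ell<\infty$. *)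

(* Defs.v *)
From HB Require Import structures.
From mathcomp Require Import all_boot all_order all_algebra.
From mathcomp Require Import all_classical all_reals all_analysis.
Import Order.TTheory GRing.Theory Num.Theory.
Import numFieldNormedType.Exports.

Set Implicit Arguments.
Unset Strict Implicit.
Unset Printing Implicit Defensive.

Local Open Scope classical_set_scope.
Local Open Scope ring_scope.

(* Rodrigues' formula; this is the normalization with P_l(1) = 1. *)
Definition legendre (R : realType) (l : nat) : {poly R} :=
  (2 ^+ l * l`!%:R)^-1 *: (('X^2 - 1) ^+ l)^`(l).

(* Functions on [-1, 1] are represented by functions R -> R of which only the
   values on [-1, 1] matter: the nodes below lie in [-1, 1]. *)
Definition bernstein4 (R : realType) (f : R -> R) (t : R) : R :=
  \sum_(j < 5) f (- 1 + j%:R / 2) * 'C(4, j)%:R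
    * ((1 + t) / 2) ^+ j * ((1 - t) / 2) ^+ (4 - j).

Definition dotr (R : realType) (n : nat) (x y : 'rV[R]_n) : R :=
  \sum_(i < n) x 0 i * y 0 i.

Definition sphere2 (R : realType) : set 'rV[R]_3 := [set x | dotr x x = 1].
Arguments sphere2 : clear implicits.

Definition possemidef (R : realType) (n : nat) (A : 'M[R]_n) : Prop :=
  A^T = A /\ forall c : 'cV[R]_n, 0 <= (c^T *m A *m c) 0 0.

(* The points x_p need not be distinct. *)
Definition posdef_sphere2 (R : realType) (phi : R -> R) : Prop :=
  {within `[-1, 1], continuous phi} /\
  forall (N : nat) (x : 'I_N -> 'rV[R]_3),
    (forall p, sphere2 R (x p)) ->
    possemidef (\matrix_(p, q) phi (dotr (x p) (x q))).

(* Main.v *)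
Require Import Defs.
From HB Require Import structures.
From mathcomp Require Import all_boot all_order all_algebra.
From mathcomp Require Import all_classical all_reals all_analysis.
From mathcomp Require Import ring lra.
Import Order.TTheory GRing.Theory Num.Theory.
Import numFieldNormedType.Exports.
Set Implicit Arguments.
Unset Strict Implicit.
Unset Printing Implicit Defensive.
Local Open Scope ring_scope.

(** The first claim is a computation: Rodrigues' formula gives $P_0$, $P_2$,
    $P_4$, $P_6$ explicitly, and the operator only sees the values of $P_6$ at
    the five nodes.

    $P_6$ is positive-definite by the addition theorem
    (legendre6_addition): on the sphere, $P_6(u \cdot v)$ is a sum of thirteen
    terms $d\, g(u) g(v)$ with $d \ge 0$, where the $g$ are the real spherical
    harmonics of degree 6, so each Gram matrix is a nonnegative combination of
    matrices $g g^T$.  With $u = (x, y, z)$, the harmonics of order $m$ are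
    $A_m(z)$ times the real and imaginary parts of $(x + i y)^m$, where $A_m$
    is a multiple of the $m$-th derivative of $P_6$.

    $B_4[P_6]$ is not positive-definite because of the sign of its $t^4$
    coefficient.  Weight the two vectors of an orthonormal basis of a plane
    by $1$ and those of another one, at an angle with cosine $a$ and sine $b$,
    by $-1$.  For an even function $\varphi$ the quadratic form is
    $4(\varphi(0) + \varphi(1) - \varphi(a) - \varphi(b))$
    (posdef_sphere2_orthonormal_pair).  Constants and $t^2$ contribute nothing
    since $a^2 + b^2 = 1$, and $t^4$ contributes
    $4(1 - a^4 - b^4) = 8 a^2 b^2 > 0$ times its negative coefficient. *)

(** * Legendre polynomials of low degree *)

(** One step of Rodrigues' formula; iterating it keeps the powers of $X^2 - 1$
    factored out, so the coefficients stay small. *)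
Lemma deriv_rodrigues_step (R : realType) (n : nat) (q r : {poly R}) :
  n.+1%:R * 2 * 'X * q + ('X^2 - 1) * q^`() = r ->
  (('X^2 - 1) ^+ n.+1 * q)^`() = ('X^2 - 1) ^+ n * r.
Proof.
move=> <-; rewrite derivM deriv_exp derivB derivXn derivC subr0 /= expr1.
rewrite -['X *+ 2]mulr_natl -[_ *+ n.+1]mulr_natl [_ ^+ n.+1]exprS; ring.
Qed.

Lemma legendre0E (R : realType) (t : R) : (legendre R 0).[t] = 1.
Proof.
rewrite /legendre derivn0 !expr0 mul1r (_ : 0`! = 1%N) // invr1 scale1r.
exact: hornerC.
Qed.

Lemma legendre2E (R : realType) (t : R) :
  (legendre R 2).[t] = (3 * t ^+ 2 - 1) / 2.
Proof.
rewrite /legendre !derivnS derivn0 -[('X^2 - 1) ^+ _]mulr1.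
rewrite (@deriv_rodrigues_step _ _ _ (4%:P * 'X)); last by rewrite !poly.derivE; ring.
rewrite (@deriv_rodrigues_step _ _ _ (4%:P * (3%:P * 'X^2 - 1))); last first.
  by rewrite !poly.derivE; ring.
rewrite expr0 mul1r (_ : 2`! = 2%N) // !hornerE /=; field; done.
Qed.

Lemma legendre4E (R : realType) (t : R) :
  (legendre R 4).[t] = (35 * t ^+ 4 - 30 * t ^+ 2 + 3) / 8.
Proof.
rewrite /legendre !derivnS derivn0 -[('X^2 - 1) ^+ _]mulr1.
rewrite (@deriv_rodrigues_step _ _ _ (8%:P * 'X)); last by rewrite !poly.derivE; ring.
rewrite (@deriv_rodrigues_step _ _ _ (8%:P * (7%:P * 'X^2 - 1))); last first.
  by rewrite !poly.derivE; ring.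
rewrite (@deriv_rodrigues_step _ _ _ (48%:P * (7%:P * 'X^3 - 3%:P * 'X)));
  last by rewrite !poly.derivE; ring.
rewrite (@deriv_rodrigues_step _ _ _
  (48%:P * (35%:P * 'X^4 - 30%:P * 'X^2 + 3%:P))); last by rewrite !poly.derivE; ring.
rewrite expr0 mul1r (_ : 4`! = 24%N) // !hornerE /=; field; done.
Qed.

Lemma legendre6E (R : realType) (t : R) :
  (legendre R 6).[t]
    = (231 * t ^+ 6 - 315 * t ^+ 4 + 105 * t ^+ 2 - 5) / 16.
Proof.
rewrite /legendre !derivnS derivn0 -[('X^2 - 1) ^+ _]mulr1.
rewrite (@deriv_rodrigues_step _ _ _ (12%:P * 'X)); last by rewrite !poly.derivE; ring.
rewrite (@deriv_rodrigues_step _ _ _ (12%:P * (11%:P * 'X^2 - 1)));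
  last by rewrite !poly.derivE; ring.
rewrite (@deriv_rodrigues_step _ _ _ (120%:P * (11%:P * 'X^3 - 3%:P * 'X)));
  last by rewrite !poly.derivE; ring.
rewrite (@deriv_rodrigues_step _ _ _
    (360%:P * (33%:P * 'X^4 - 18%:P * 'X^2 + 1))); last by rewrite !poly.derivE; ring.
rewrite (@deriv_rodrigues_step _ _ _
    (2880%:P * (33%:P * 'X^5 - 30%:P * 'X^3 + 5%:P * 'X)));
  last by rewrite !poly.derivE; ring.
rewrite (@deriv_rodrigues_step _ _ _
    (2880%:P * (231%:P * 'X^6 - 315%:P * 'X^4 + 105%:P * 'X^2 - 5%:P)));
  last by rewrite !poly.derivE; ring.
rewrite expr0 mul1r (_ : 6`! = 720%N) // !hornerE /=; field; done.
Qed.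

(** * The Bernstein image of the sixth Legendre polynomial *)

Lemma bernstein4_legendre6 (R : realType) (t : R) :
  bernstein4 (horner (legendre R 6)) t
    = 347 / 2048 + 63 / 64 * t ^+ 2 - 315 / 2048 * t ^+ 4.
Proof.
rewrite /bernstein4 !big_ord_recr big_ord0 /= !legendre6E.
have [-> -> ->] : [/\ 'C(4, 1) = 4%N, 'C(4, 2) = 6%N & 'C(4, 3) = 4%N] by [].
rewrite bin0 binn !subSS !subn0.
by field.
Qed.

(** * Positive-semidefinite kernels *)

Definition psd_kernel (R : realType) (T : Type) (K : T -> T -> R) : Prop :=
  forall (N : nat) (x : 'I_N -> T), possemidef (\matrix_(p, q) K (x p) (x q)).

Lemma psd_kernelD (R : realType) (T : Type) (K L : T -> T -> R) :
  psd_kernel K -> psd_kernel L -> psd_kernel (fun u v => K u v + L u v).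
Proof.
move=> hK hL N x; have [symK posK] := hK N x; have [symL posL] := hL N x.
have -> : \matrix_(p, q) (K (x p) (x q) + L (x p) (x q))
    = \matrix_(p, q) K (x p) (x q) + \matrix_(p, q) L (x p) (x q).
  by apply/matrixP => p q; rewrite !mxE.
split; first by rewrite linearD /= symK symL.
by move=> c; rewrite mulmxDr mulmxDl mxE addr_ge0.
Qed.

(** The Gram matrix is $d\, w w^T$ with $w_p = g(x_p)$, so its quadratic form
    is $d$ times a square. *)
Lemma psd_kernel_rank1 (R : realType) (T : Type) (d : R) (g : T -> R) :
  0 <= d -> psd_kernel (fun u v => d * (g u * g v)).
Proof.
move=> d0 N x; pose w : 'cV[R]_N := \col_p g (x p).
have -> : \matrix_(p, q) (d * (g (x p) * g (x q))) = d *: (w *m w^T).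
  by apply/matrixP => p q; rewrite !mxE big_ord1 !mxE.
split; first by rewrite linearZ /= trmx_mul trmxK.
move=> c; rewrite -scalemxAr -scalemxAl mxE mulr_ge0 //.
have -> : c^T *m (w *m w^T) *m c = (c^T *m w) *m (c^T *m w)^T.
  by rewrite trmx_mul trmxK !mulmxA.
by rewrite mxE big_ord1 [_^T _ _]mxE -expr2 sqr_ge0.
Qed.

(** * The addition theorem in degree 6 *)

(** Real and imaginary parts of $(x + i y)^m$. *)
Fixpoint cexp (R : realType) (x y : R) (m : nat) : R * R :=
  if m is m'.+1 then
    let w := cexp x y m' in (x * w.1 - y * w.2, x * w.2 + y * w.1)
  else (1, 0).

(** $\Re\bigl((x + i y)^m \overline{(x' + i y')^m}\bigr)$, for $u = (x, y, z)$
    and $v = (x', y', z')$. *)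
Definition cexp_dot (R : realType) (m : nat) (u v : 'rV[R]_3) : R :=
  (cexp (u 0 0) (u 0 1) m).1 * (cexp (v 0 0) (v 0 1) m).1
  + (cexp (u 0 0) (u 0 1) m).2 * (cexp (v 0 0) (v 0 1) m).2.

(** Chebyshev's recurrence, from $\omega + \bar\omega = 2a$ and
    $\omega\bar\omega = r$ for $\omega = (x + i y)\overline{(x' + i y')}$.  On
    the sphere $r = (1 - z^2)(1 - z'^2)$, so the recurrence expresses each
    term through $z$, $z'$ and $a$ alone. *)
Lemma cexp_dotSS (R : realType) (m : nat) (u v : 'rV[R]_3) :
  cexp_dot m.+2 u v
    = 2 * (u 0 0 * v 0 0 + u 0 1 * v 0 1) * cexp_dot m.+1 u v
      - (u 0 0 ^+ 2 + u 0 1 ^+ 2) * (v 0 0 ^+ 2 + v 0 1 ^+ 2)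
        * cexp_dot m u v.
Proof. rewrite /cexp_dot /=; ring. Qed.

Lemma cexp_dot0 (R : realType) (u v : 'rV[R]_3) : cexp_dot 0 u v = 1.
Proof. rewrite /cexp_dot /=; ring. Qed.

Lemma cexp_dot1 (R : realType) (u v : 'rV[R]_3) :
  cexp_dot 1 u v = u 0 0 * v 0 0 + u 0 1 * v 0 1.
Proof. rewrite /cexp_dot /=; ring. Qed.

Definition harmonic_term (R : realType) (d : R) (A : R -> R) (m : nat)
    (u v : 'rV[R]_3) : R :=
  d * (A (u 0 2%:R) * A (v 0 2%:R)) * cexp_dot m u v.

(** Each term is the sum of two rank-one kernels, one for each of the two real
    harmonics of order $m$. *)
Lemma psd_kernel_harmonic_term (R : realType) (d : R) (A : R -> R) (m : nat) :
  0 <= d -> psd_kernel (harmonic_term d A m).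
Proof.
move=> d0.
pose g (u : 'rV[R]_3) := A (u 0 2%:R) * (cexp (u 0 0) (u 0 1) m).1.
pose h (u : 'rV[R]_3) := A (u 0 2%:R) * (cexp (u 0 0) (u 0 1) m).2.
have -> : harmonic_term d A m
    = fun u v => d * (g u * g v) + d * (h u * h v).
  apply/funext => u; apply/funext => v.
  rewrite /harmonic_term /cexp_dot /g /h; ring.
by apply: psd_kernelD; apply: psd_kernel_rank1.
Qed.

(** The addition theorem
    $P_6(u \cdot v) = \sum_m c_m P_6^{(m)}(z) P_6^{(m)}(z')
      \Re\bigl((x + i y)^m \overline{(x' + i y')^m}\bigr)$ with $c_0 = 1$ and
    $c_m = 2 (6 - m)! / (6 + m)!$, the contents of the derivatives being
    moved into the constants. *)
Definition legendre6_kernel (R : realType) (u v : 'rV[R]_3) : R :=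
  harmonic_term (256^-1)
    (fun z => 231 * z ^+ 6 - 315 * z ^+ 4 + 105 * z ^+ 2 - 5) 0 u v
  + harmonic_term (21 / 64) (fun z => 33 * z ^+ 5 - 30 * z ^+ 3 + 5 * z) 1 u v
  + harmonic_term (105 / 512) (fun z => 33 * z ^+ 4 - 18 * z ^+ 2 + 1) 2 u v
  + harmonic_term (105 / 128) (fun z => 11 * z ^+ 3 - 3 * z) 3 u v
  + harmonic_term (63 / 256) (fun z => 11 * z ^+ 2 - 1) 4 u v
  + harmonic_term (693 / 128) (fun z => z) 5 u v
  + harmonic_term (231 / 512) (fun=> 1) 6 u v.

Lemma dotr3E (R : realType) (u v : 'rV[R]_3) :
  dotr u v = u 0 0 * v 0 0 + u 0 1 * v 0 1 + u 0 2%:R * v 0 2%:R.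
Proof.
rewrite /dotr !big_ord_recr big_ord0 /= add0r.
by congr (_ * _ + _ * _ + _ * _); congr (_ _ _); apply/val_inj.
Qed.

Lemma legendre6_addition (R : realType) (u v : 'rV[R]_3) :
  sphere2 R u -> sphere2 R v ->
  (legendre R 6).[dotr u v] = legendre6_kernel u v.
Proof.
rewrite /sphere2 /= legendre6E !dotr3E /legendre6_kernel /harmonic_term.
rewrite !cexp_dotSS cexp_dot1 cexp_dot0 => su sv.
have -> : u 0 0 ^+ 2 + u 0 1 ^+ 2 = 1 - u 0 2%:R ^+ 2 by rewrite -su; ring.
have -> : v 0 0 ^+ 2 + v 0 1 ^+ 2 = 1 - v 0 2%:R ^+ 2 by rewrite -sv; ring.
(* Only the two heights and this scalar remain in the identity. *)
set a := u 0 0 * v 0 0 + u 0 1 * v 0 1.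
move: (u 0 2%:R) (v 0 2%:R) a => z z' {su sv}a; by field.
Qed.

Lemma psd_legendre6_kernel (R : realType) : psd_kernel (@legendre6_kernel R).
Proof.
by do 6![apply: psd_kernelD; last by apply: psd_kernel_harmonic_term; lra];
  apply: psd_kernel_harmonic_term; lra.
Qed.

Lemma posdef_sphere2_legendre6 (R : realType) :
  posdef_sphere2 (horner (legendre R 6)).
Proof.
split; first by apply: continuous_subspaceT; exact: continuous_horner.
move=> N x hx.
have -> : \matrix_(p, q) (legendre R 6).[dotr (x p) (x q)]
    = \matrix_(p, q) legendre6_kernel (x p) (x q).
  by apply/matrixP => p q; rewrite !mxE legendre6_addition.
exact: psd_legendre6_kernel.
Qed.

(** * A necessary condition for positive-definiteness *)

Definition vec3 (R : realType) (x y z : R) : 'rV[R]_3 :=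
  \row_j [:: x; y; z]`_j.

Lemma dotr_vec3 (R : realType) (x y z x' y' z' : R) :
  dotr (vec3 x y z) (vec3 x' y' z') = x * x' + y * y' + z * z'.
Proof. by rewrite dotr3E !mxE. Qed.

(** Test the Gram matrix of two orthonormal bases of a plane, $e_1, e_2$ and
    $(a, b), (b, -a)$, against the weights $1, 1, -1, -1$. *)
Lemma posdef_sphere2_orthonormal_pair (R : realType) (phi : R -> R) (a b : R) :
  posdef_sphere2 phi -> (forall t, phi (- t) = phi t) ->
  a ^+ 2 + b ^+ 2 = 1 -> phi a + phi b <= phi 0 + phi 1.
Proof.
move=> [_ hphi] even ab1.
pose s := [:: vec3 1 0 0; vec3 0 1 0; vec3 a b 0; vec3 b (- a) 0].
pose x (p : 'I_4) := s`_p.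
have hx p : sphere2 R (x p).
  rewrite /sphere2 /x /s /=.
  by case: p => [[|[|[|[|//]]]] ?] /=; rewrite dotr_vec3; lra.
have [_ /(_ (\col_p [:: 1; 1; -1; -1]`_p))] := hphi 4 x hx.
rewrite !mxE !big_ord_recl big_ord0 !mxE !big_ord_recl !big_ord0 !mxE /=.
rewrite /x /s /= !dotr_vec3.
rewrite !(mulr1, mul1r, mulr0, mul0r, addr0, add0r) !mulNr !mulrN !even.
rewrite opprK [b * a]mulrC !subrr [b * b + _]addrC -!expr2 ab1; lra.
Qed.

(** * Failure of preservation by the Bernstein operator *)

Theorem mainTheorem2 (R : realType) :
  [/\ forall t : R, -1 <= t <= 1 ->
        bernstein4 (horner (legendre R 6)) t
          = 347 / 2048 + 63 / 64 * t ^+ 2 - 315 / 2048 * t ^+ 4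
        /\ bernstein4 (horner (legendre R 6)) t
          = 239 / 512 * (legendre R 0).[t] + 291 / 512 * (legendre R 2).[t]
            - 9 / 256 * (legendre R 4).[t],
      posdef_sphere2 (horner (legendre R 6)),
      ~ posdef_sphere2 (bernstein4 (horner (legendre R 6)))
    & ~ (forall phi : R -> R,
           posdef_sphere2 phi -> posdef_sphere2 (bernstein4 phi)) ].
Proof.
have notpd : ~ posdef_sphere2 (bernstein4 (horner (legendre R 6))).
  move=> pd.
  have even (t : R) : bernstein4 (horner (legendre R 6)) (- t)
      = bernstein4 (horner (legendre R 6)) t.
    by rewrite !bernstein4_legendre6; ring.
  (* A rational point of the circle avoids square roots. *)
  have ab1 : (3 / 5) ^+ 2 + (4 / 5) ^+ 2 = 1 :> R by field.
  have := posdef_sphere2_orthonormal_pair pd even ab1.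
  by rewrite !bernstein4_legendre6; lra.
split=> //.
- move=> t _; split; first exact: bernstein4_legendre6.
  by rewrite bernstein4_legendre6 legendre0E legendre2E legendre4E; field.
- exact: posdef_sphere2_legendre6.
- by move=> preserves; apply: notpd; apply/preserves/posdef_sphere2_legendre6.
Qed.
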